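(* Let $n\ge 0$ be an integer and let $\widetilde{M}^n$ be the $(n+1)\times(n+1)$ Hankel matrix with entries $\widetilde{M}^n_{ij}=\frac{(2n-i-j)!\,(i+j)!}{(2n+1)!}$, $0\le i,j\le n$. For $0\le i\le n+1$ put $$u^n_i=(-1)^{n+i}(n+1)\binom{n}{i}\binom{n+1}{i},\qquad v^{n+1}_i=(-1)^{i+1}(n+1)\binom{n+1}{i}\binom{n}{i-1}.$$ Then $\widetilde{M}^n$ is invertible and for all $0\le i,j\le n$, $$\left(\widetilde{M}^n\right)^{-1}_{ij} = \frac{1}{v^{n+1}_{n+1}}\sum_{k=0}^{\min\{i,n-j\}}\left(u^n_{i-k}v^{n+1}_{j+k+1}-u^n_{j+k+1}v^{n+1}_{i-k}\right) = (-1)^{i+j}\sum_{k=0}^{\min\{i,n-j\}}(2k+1-i+j)\binom{n+1}{i-k}^2\binom{n+1}{j+k+1}^2.$$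
   Context: Matrix indices run from $0$ to $n$. Convention: $\binom{m}{k}=0$ if $k<0$ or $k>m$ (so in particular $u^n_{n+1}=0$ and $v^{n+1}_0=0$). *)

(* Defs.v *)
From mathcomp Require Import all_boot all_order all_algebra.

Set Implicit Arguments.
Unset Strict Implicit.
Unset Printing Implicit Defensive.

Import GRing.Theory.
Local Open Scope ring_scope.

(* The truncated subtraction in nat is exact here, since i, j <= n. *)
Definition Mtilde (n : nat) : 'M[rat]_n.+1 :=
  \matrix_(i < n.+1, j < n.+1)
    ((((2 * n - i - j)%N)`! * ((i + j)%N)`!)%N%:R / ((2 * n + 1)%N)`!%:R).

Definition u (n i : nat) : rat :=
  (-1) ^+ (n + i) * (n + 1)%:R * 'C(n, i)%:R * 'C(n + 1, i)%:R.

(* v n i stands for v^n_i, for n >= 1: it is only used as v n.+1, where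
   n.+1.-1 is n.  The case i = 0 is separate because 'C(n, -1) = 0, whereas
   0.-1 = 0 would give 'C(n, 0) = 1. *)
Definition v (n i : nat) : rat :=
  if i is i'.+1 then
    (-1) ^+ (i + 1) * n%:R * 'C(n, i)%:R * 'C(n.-1, i')%:R
  else 0.

(* Main.v *)
Require Import Defs.
From mathcomp Require Import all_boot all_order all_algebra.
From mathcomp Require Import zify ring.

Set Implicit Arguments.
Unset Strict Implicit.
Unset Printing Implicit Defensive.

Import GRing.Theory Num.Theory.
Local Open Scope ring_scope.

(** The entries of [Mtilde n] are [h (i + j)] with
[h m = m! (2 n - m)! / (2 n + 1)!], a Hankel matrix.  Let [L] be the linear
form on polynomials of degree at most [2 n] with [L (t ^ m) = h m], and let [u]
and [v] stand for the polynomials with coefficients [u n a] and [v n.+1 a], of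
degrees [n] and [n + 1].

They are orthogonal polynomials for [L]: [L (t ^ k u) = 0] and
[L (t ^ k v) = 0] for [k < n], while [L (t ^ n u) = 1] ([u_orth], [v_orth],
[u_norm]).  Once the binomials are written with factorials, each of these sums
is an alternating sum of [(-1) ^ j 'C(N, j) p(j)] for a polynomial [p] of degree
less than [N], i.e., an [N]-th finite difference, which vanishes
([alternating_bin_sum_ffact]).  For [u_norm] the sum stops one term short of
such a difference, so its value is minus the missing term.

The inverse then comes from the Bezoutian
[B(s, t) = (u(s) v(t) - u(t) v(s)) / (t - s) = \sum_(i, j) b i j s ^ i t ^ j].
Put [f_k(s) = L_t (t ^ k B(s, t))], whose coefficient of [s ^ i] is the [(i, k)]
entry of the product of [(b i j)] by the Hankel matrix.  For [k < n],
orthogonality gives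
[f_(k+1)(s) - s f_k(s) = u(s) L (t ^ k v) - v(s) L (t ^ k u) = 0],
so [f_k = s ^ k f_0].  As [f_n] has degree at most [n], [f_0] is a constant; it
is the coefficient of [s ^ n] in [f_n], namely [v_(n+1) L (t ^ n u) = v_(n+1)].
Hence the product is [v_(n+1)] times the identity ([bezout_mul_hankel]).

The last expression of the theorem agrees with the middle one term by term
([bezw_uv]), because [u_a] and [v_a] are the multiples of ['C(n + 1, a) ^ 2] by
[(n + 1 - a)] and by [a], up to sign ([uE], [vE]). *)

(** * Alternating binomial sums *)

Section AlternatingSums.

Variable R : idomainType.

(** Writing [p = q 'X + c], the constant contributes [c (1 - 1) ^ N] and the
identity [j 'C(N, j) = N 'C(N - 1, j - 1)] turns the rest into the sum of order
[N - 1] for the shifted polynomial [q(X + 1)], whose size is one less. *)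
Lemma alternating_bin_sum_poly (N : nat) (p : {poly R}) :
  (size p <= N)%N ->
  \sum_(j < N.+1) (-1) ^+ j * 'C(N, j)%:R * p.[j%:R] = 0.
Proof.
elim: N p => [|N IHN] p.
  by rewrite leqn0 size_poly_eq0 => /eqP ->; rewrite big_ord1 horner0 mulr0.
elim/poly_ind: p => [|q c _] szp.
  by rewrite big1 // => j _; rewrite horner0 mulr0.
have szq : (size (q \Po ('X + 1%:P)) <= N)%N.
  rewrite size_comp_poly2; last by rewrite size_XaddC.
  have [->|q0] := eqVneq q 0; first by rewrite size_poly0.
  by move: szp; rewrite size_MXaddC (negPf q0).
under eq_bigr => j _ do rewrite hornerMXaddC mulrDr.
rewrite big_split /= -mulr_suml.
have -> : \sum_(j < N.+2) (-1) ^+ j * 'C(N.+1, j)%:R = 0 :> R.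
  have := exprDn (1 : R) (- 1) N.+1; rewrite subrr expr0n /= => /esym sum0.
  rewrite -[RHS]sum0; apply: eq_bigr => j _.
  by rewrite expr1n mul1r mulr_natr.
rewrite mul0r addr0 big_ord_recl /= !mulr0 add0r.
have /(congr1 ( *%R (- N.+1%:R))) := IHN _ szq; rewrite mulr0 => sumq.
rewrite -[RHS]sumq mulr_sumr.
apply: eq_bigr => j _; rewrite /bump leq0n add1n.
rewrite horner_comp hornerD hornerX hornerC natr1.
have /(congr1 (GRing.natmul (1 : R))) := mul_bin_diag N.+1 j.
rewrite /= !natrM exprS => E.
transitivity (- (-1) ^+ j * (j.+1%:R * 'C(N.+1, j.+1)%:R) * q.[j.+1%:R]).
  by ring.
by rewrite -E; ring.
Qed.

(** Falling factorials of affine functions of [j] are polynomials in [j], of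
degrees [a] and [b] here; [N <= d] keeps the truncated [d - j] exact. *)
Lemma alternating_bin_sum_ffact (N a b c d : nat) :
  (a + b < N)%N -> (N <= d)%N ->
  \sum_(j < N.+1) (-1) ^+ j * 'C(N, j)%:R *
    (((j + c + a) ^_ a)%:R * ((d - j + b) ^_ b)%:R) = 0 :> R.
Proof.
move=> abN Nd.
(* As ['X - (d + b - l)] is the opposite of the wanted factor [d - j + b - l], the
   product [p * q] has to be scaled by [(-1) ^ b]. *)
pose p : {poly R} := \prod_(l < a) ('X - (- (c + a - l)%:R)%:P).
pose q : {poly R} := \prod_(l < b) ('X - (d + b - l)%:R%:P).
have size_prodX m (F : 'I_m -> R) : size (\prod_l ('X - (F l)%:P)) = m.+1.
  by rewrite -big_enum size_prod_XsubC size_enum_ord.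
have szpq : (size ((-1) ^+ b *: (p * q)) <= N)%N.
  apply: leq_trans (size_scale_leq _ _) _.
  by apply: leq_trans (size_polyMleq _ _) _; rewrite !size_prodX addnS /= addSn.
rewrite -[RHS](alternating_bin_sum_poly szpq); apply: eq_bigr => j _.
congr (_ * _); rewrite hornerZ hornerM !horner_prod !ffact_prod mulrCA.
congr (_ * _); first last.
  have -> : (-1) ^+ b = \prod_(l < b) (- 1 : R) by rewrite prodr_const card_ord.
  rewrite -big_split /= natr_prod; apply: eq_bigr => l _.
  rewrite hornerXsubC -(_ : (d - j + b - l + j)%N = d + b - l)%N; last first.
    by have := ltn_ord l; have := ltn_ord j; lia.
  by rewrite natrD; ring.
rewrite natr_prod; apply: eq_bigr => l _.
by rewrite hornerXsubC opprK -natrD; congr _%:R; have := ltn_ord l; lia.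
Qed.

End AlternatingSums.

(** * The Bezoutian of two orthogonal polynomials inverts a Hankel matrix *)

Section Bezoutian.

Variables (R : comNzRingType) (u v : nat -> R).

Definition bezw (a b : nat) : R := u a * v b - u b * v a.

(** Coefficient of [s ^ i t ^ j] in [(u(s) v(t) - u(t) v(s)) / (t - s)].  The sum
is not cut at the degrees of [u] and [v], so that the recurrence
[bezout_coefS] holds for all [i] and [j]. *)
Definition bezout_coef (i j : nat) : R :=
  \sum_(k < i.+1) bezw (i - k) (j + k).+1.

Lemma bezwC a b : bezw a b = - bezw b a.
Proof. by rewrite /bezw; ring. Qed.

Lemma bezwaa a : bezw a a = 0.
Proof. by rewrite /bezw; ring. Qed.

Lemma bezout_coef0 j : bezout_coef 0 j = bezw 0 j.+1.
Proof. by rewrite /bezout_coef big_ord1 addn0. Qed.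

(** Coefficient of [s ^ i.+1 t ^ j.+1] in [(t - s) B = u(s) v(t) - u(t) v(s)]. *)
Lemma bezout_coefS i j :
  bezout_coef i.+1 j = bezw i.+1 j.+1 + bezout_coef i j.+1.
Proof.
rewrite /bezout_coef big_ord_recl subn0 addn0; congr (_ + _).
by apply: eq_bigr => k _; rewrite lift0 subSS addnS.
Qed.

(** The numerator [u(s) v(t) - u(t) v(s)] vanishes at [s = t]: this is what makes
the division by [t - s] exact. *)
Lemma bezw_antidiag_sum m : \sum_(k < m.+1) bezw (m - k) k = 0.
Proof.
rewrite /bezw sumrB; apply/eqP; rewrite subr_eq0; apply/eqP.
rewrite [RHS](reindex_inj rev_ord_inj) /=; apply: eq_bigr => k _.
by rewrite subSS subKn // -ltnS.
Qed.

(** Exchanging [s] and [t] changes the sign of both numerator and denominator. *)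
Lemma bezout_coefC i j : bezout_coef i j = bezout_coef j i.
Proof.
elim: i j => [|i IHi] j.
  have := bezw_antidiag_sum j.+1; rewrite big_ord_recl subn0 => /eqP.
  rewrite addr_eq0 bezwC eqr_opp => /eqP E; rewrite bezout_coef0 E.
  by apply: eq_bigr => k _; rewrite lift0 subSS add0n.
by rewrite bezout_coefS IHi bezout_coefS addrA [bezw i.+1 _]bezwC addNr add0r.
Qed.

Variable n : nat.
Hypothesis u_deg : forall a, (n < a)%N -> u a = 0.
Hypothesis v_deg : forall a, (n.+1 < a)%N -> v a = 0.

Lemma bezout_coef_gt i j : (n < j)%N -> bezout_coef i j = 0.
Proof.
move=> ltnj; apply: big1 => k _.
by rewrite /bezw [u (j + k).+1]u_deg ?[v (j + k).+1]v_deg ?mulr0 ?mul0r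
  ?subr0 //; lia.
Qed.

(** Compare the coefficients of [s ^ n.+1] in [(t - s) B = u(s) v(t) - u(t) v(s)],
where [u(s)] has degree at most [n]. *)
Lemma bezout_coef_last j : bezout_coef n j = u j * v n.+1.
Proof.
have -> : bezout_coef n j = bezw j n.+1.
  case: j => [|j]; first by rewrite bezout_coefC bezout_coef0.
  have := bezout_coefS n j; rewrite bezout_coefC bezout_coef_gt // => /esym/eqP.
  by rewrite addrC addr_eq0 -bezwC => /eqP.
by rewrite /bezw (u_deg (ltnSn n)) mul0r subr0.
Qed.

Lemma bezout_coef_minn i j : (j <= n)%N ->
  bezout_coef i j =
  \sum_(0 <= k < (minn i (n - j)).+1)
    (u (i - k) * v (j + k + 1) - u (j + k + 1) * v (i - k)).
Proof.
move=> lejn; have lemi : ((minn i (n - j)).+1 <= i.+1)%N by rewrite ltnS geq_minl.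
rewrite /bezout_coef -(big_mkord xpredT (fun k => bezw (i - k) (j + k).+1)).
rewrite (big_cat_nat _ lemi) //=.
have -> : \sum_((minn i (n - j)).+1 <= k < i.+1) bezw (i - k) (j + k).+1 = 0.
  rewrite big_nat big1 // => k /andP[lek lti]; rewrite /bezw.
  by rewrite [u (j + k).+1]u_deg ?[v (j + k).+1]v_deg ?mulr0 ?mul0r
  ?subr0 //; lia.
by rewrite addr0; apply: eq_bigr => k _; rewrite /bezw addn1.
Qed.

Variable h : nat -> R.
Hypothesis u_orth :
  forall k, (k < n)%N -> \sum_(j < n.+1) u j * h (j + k) = 0.
Hypothesis u_norm : \sum_(j < n.+1) u j * h (j + n) = 1.
Hypothesis v_orth :
  forall k, (k < n)%N -> \sum_(j < n.+2) v j * h (j + k) = 0.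

(** Coefficient of [s ^ i] in [f_k(s) = L_t (t ^ k B(s, t))]. *)
Let moment i k := \sum_(j < n.+1) bezout_coef i j * h (j + k).

(** The numerator is killed by [L_t (t ^ k _)]; its [t ^ 0] term is put apart
because the terms [t ^ j.+1] are the ones met when [bezout_coefS] is applied
under the sum. *)
Lemma bezw_moment i k : (k < n)%N ->
  \sum_(j < n.+1) bezw i j.+1 * h (j + k.+1) = - (bezw i 0 * h k).
Proof.
move=> ltkn; apply/eqP; rewrite -subr_eq0 opprK addrC; apply/eqP.
have -> : bezw i 0 * h k + \sum_(j < n.+1) bezw i j.+1 * h (j + k.+1) =
          \sum_(j < n.+2) bezw i j * h (j + k).
  rewrite [RHS]big_ord_recl add0n; congr (_ + _).
  by apply: eq_bigr => j _; rewrite lift0 addSnnS.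
have u_orth' : \sum_(j < n.+2) u j * h (j + k) = 0.
  by rewrite big_ord_recr /= u_orth // u_deg // mul0r addr0.
transitivity (u i * (\sum_(j < n.+2) v j * h (j + k))
              - v i * (\sum_(j < n.+2) u j * h (j + k))).
  rewrite !mulr_sumr -sumrB; apply: eq_bigr => j _; rewrite /bezw; ring.
by rewrite u_orth' v_orth // !mulr0 subr0.
Qed.

(** [f_(k+1) = s f_k], away from the constant coefficient. *)
Lemma momentSS i k : (k < n)%N -> moment i.+1 k.+1 = moment i k.
Proof.
move=> ltkn; rewrite /moment.
under eq_bigr do rewrite bezout_coefS mulrDl.
rewrite big_split /= bezw_moment // -mulNr -bezwC -bezout_coef0 bezout_coefC.
transitivity (\sum_(j < n.+2) bezout_coef i j * h (j + k)).
  rewrite [RHS]big_ord_recl add0n; congr (_ + _).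
  by apply: eq_bigr => j _; rewrite lift0 addSnnS.
by rewrite big_ord_recr /= bezout_coef_gt // mul0r addr0.
Qed.

(** By [momentSS] a moment only depends on [i - k], so it can be read on the border:
the row [n], where [u_norm] applies, on the diagonal; the row [n.+1], which is
zero for degree reasons, below it; the row [0] above it. *)
Lemma moment_delta i k : (i <= n)%N -> (k <= n)%N ->
  moment i k = v n.+1 * (i == k)%:R.
Proof.
move=> lein lekn.
have shift d i' k' : (d + k' <= n)%N -> moment (d + i') (d + k') = moment i' k'.
  elim: d => [|d IHd] ledk //.
  by rewrite !addSn momentSS // IHd // ltnW.
have [ltik|ltki|eqik] := ltngtP i k; last first.
- have := shift (n - k)%N i k; rewrite eqik subnK // => <- //.
  rewrite mulr1 /moment; under eq_bigr do rewrite bezout_coef_last mulrAC mulrC.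
  by rewrite -mulr_sumr u_norm mulr1.
- have := shift (n.+1 - i)%N i k; rewrite subnK; last by rewrite ltnW.
  rewrite mulr0 => <-; last by lia.
  by apply: big1 => j _; rewrite bezout_coefC bezout_coef_gt // mul0r.
have := shift i 0%N (k - i)%N; rewrite addn0 subnKC; last exact: ltnW.
move=> -> //; rewrite mulr0 -(prednK (_ : 0 < k - i)%N) ?subn_gt0 //.
rewrite /moment; under eq_bigr do rewrite bezout_coef0.
by rewrite bezw_moment ?bezwaa ?mul0r ?oppr0 //; lia.
Qed.

Lemma bezout_mul_hankel :
  (\matrix_(i < n.+1, j < n.+1) bezout_coef i j) *m
  (\matrix_(i < n.+1, j < n.+1) h (i + j)) = (v n.+1)%:M.
Proof.
apply/matrixP => i k.
have lein : (i <= n)%N := leq_ord i; have lekn : (k <= n)%N := leq_ord k.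
rewrite !mxE -mulr_natr -[i == k]/(val i == val k) -(moment_delta lein lekn).
by apply: eq_bigr => j _; rewrite !mxE.
Qed.

End Bezoutian.

(** * The moments of [Mtilde] and their orthogonal polynomials *)

Section FactorialMoments.

Variable n : nat.

(** These are the moments of the Beta integral
[\int_0^1 x ^ m (1 - x) ^ (2 n - m) dx]. *)
Let h (m : nat) : rat := (2 * n - m)`!%:R * m`!%:R / (2 * n + 1)`!%:R.

Lemma u_gt a : (n < a)%N -> u n a = 0.
Proof. by move=> lt; rewrite /u (bin_small lt) mulr0 mul0r. Qed.

Lemma v_gt a : (n.+1 < a)%N -> v n.+1 a = 0.
Proof. by case: a => // a lt; rewrite /v (bin_small lt) mulr0 mul0r. Qed.

Lemma uE a : (a <= n.+1)%N ->
  u n a = (-1) ^+ (n + a) * (n.+1%:R - a%:R) * 'C(n.+1, a)%:R ^+ 2.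
Proof.
move=> lea; rewrite /u addn1 -natrB // -mulrA.
have /(congr1 (GRing.natmul (1 : rat))) := mul_bin_down n.+1 a.
rewrite !natrM => E; transitivity ((-1) ^+ (n + a) *
  (n.+1%:R * 'C(n, a)%:R) * 'C(n.+1, a)%:R : rat); first by ring.
by rewrite E; ring.
Qed.

Lemma vE a : v n.+1 a = (-1) ^+ a.+1 * a%:R * 'C(n.+1, a)%:R ^+ 2.
Proof.
case: a => [|a]; first by rewrite /= mulr0 mul0r.
have /(congr1 (GRing.natmul (1 : rat))) := mul_bin_diag n.+1 a.
rewrite !natrM /v /= addn1 => E; transitivity ((-1) ^+ a.+2 *
  (n.+1%:R * 'C(n, a)%:R) * 'C(n.+1, a.+1)%:R : rat); first by ring.
by rewrite E; ring.
Qed.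

Lemma v_last : v n.+1 n.+1 = (-1) ^+ n * n.+1%:R.
Proof. by rewrite vE binn !exprS; ring. Qed.

Lemma v_last_neq0 : v n.+1 n.+1 != 0.
Proof. by rewrite v_last mulf_eq0 signr_eq0 pnatr_eq0. Qed.

(** The factor that makes a term of the orthogonality sums polynomial in [j]: the
denominators of the binomial are absorbed by the two factorials of the moment. *)
Lemma bin_mul_fact N j a b : (j <= N)%N ->
  'C(N, j)%:R * ((N - j + b)`!%:R * (j + a)`!%:R) =
  N`!%:R * (((j + a) ^_ a)%:R * ((N - j + b) ^_ b)%:R) :> rat.
Proof.
move=> lejN; have Ea := ffact_fact (leq_addl j a).
have Eb := ffact_fact (leq_addl (N - j) b).
by rewrite -Ea -Eb !addnK -(bin_fact lejN) !natrM; ring.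
Qed.

(** The term of index [j] is, up to a constant, [(-1) ^ j 'C(n, j)] times a
polynomial in [j] of degree [k + (n - 1 - k) < n]; the other binomial
['C(n + 1, j)] is used up by the factorials. *)
Lemma u_orth k : (k < n)%N -> \sum_(j < n.+1) u n j * h (j + k) = 0.
Proof.
move=> ltkn.
have alt0 := @alternating_bin_sum_ffact rat n k (n.-1 - k) 0 n.+1.
apply: (etrans _ (mulr0 ((-1) ^+ n * n.+1%:R * n.+1`!%:R / (2 * n + 1)`!%:R))).
rewrite -[X in _ = _ * X]alt0; [|lia|lia].
rewrite mulr_sumr; apply: eq_bigr => j _; rewrite /u /h addn0.
have -> : (2 * n - (j + k) = n.+1 - j + (n.-1 - k))%N by have := ltn_ord j; lia.
have E := @bin_mul_fact n.+1 j k (n.-1 - k) (ltnW (ltn_ord j)).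
transitivity ((-1) ^+ n * (-1) ^+ j * n.+1%:R * 'C(n, j)%:R *
   ('C(n.+1, j)%:R * ((n.+1 - j + (n.-1 - k))`!%:R * (j + k)`!%:R))
     / (2 * n + 1)`!%:R : rat); first by rewrite !addn1 exprD; ring.
by rewrite E; ring.
Qed.

(** Same degree count as for [u_orth], after shifting the index by one since
[v_0 = 0]. *)
Lemma v_orth k : (k < n)%N -> \sum_(j < n.+2) v n.+1 j * h (j + k) = 0.
Proof.
move=> ltkn; rewrite big_ord_recl mul0r add0r.
have alt0 := @alternating_bin_sum_ffact rat n k (n.-1 - k) 1 n.
apply: (etrans _ (mulr0 (n.+1%:R * n.+1`!%:R / (2 * n + 1)`!%:R))).
rewrite -[X in _ = _ * X]alt0; [|lia|lia].
rewrite mulr_sumr; apply: eq_bigr => j _.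
rewrite lift0 /v /h [n.+1.-1]/= addn1 [(j + 1)%N]addn1.
have -> : (2 * n - (j.+1 + k) = n - j + (n.-1 - k))%N.
  by have := ltn_ord j; lia.
have E := @bin_mul_fact n.+1 j.+1 k (n.-1 - k) (ltn_ord j).
rewrite subSS in E.
transitivity ((-1) ^+ j * n.+1%:R * 'C(n, j)%:R *
   ('C(n.+1, j.+1)%:R * ((n - j + (n.-1 - k))`!%:R * (j.+1 + k)`!%:R))
     / (2 * n + 1)`!%:R : rat); first by rewrite !exprS; ring.
by rewrite E; ring.
Qed.

(** Here ['C(n, j)] absorbs the factorials and ['C(n + 1, j)] carries the
alternating sum.  The polynomial [(j + 1) ... (j + n)] has degree [n < n + 1], so
the full sum over [j <= n + 1] is zero and the sum over [j <= n] is minus the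
term at [j = n + 1]. *)
Lemma u_norm : \sum_(j < n.+1) u n j * h (j + n) = 1.
Proof.
have := @alternating_bin_sum_ffact rat n.+1 n 0 0 n.+1.
rewrite addn0 => /(_ (ltnSn _) (leqnn _)).
rewrite big_ord_recr /= binn addn0 addSn => /eqP.
rewrite addr_eq0 => /eqP alt.
transitivity ((-1) ^+ n * n.+1`!%:R / (2 * n + 1)`!%:R *
  \sum_(j < n.+1) (-1) ^+ j * 'C(n.+1, j)%:R *
     (((j + 0 + n) ^_ n)%:R * ((n.+1 - j + 0) ^_ 0)%:R) : rat).
  rewrite mulr_sumr; apply: eq_bigr => j _; rewrite /u /h addn0.
  have -> : (2 * n - (j + n) = n - j + 0)%N by have := ltn_ord j; lia.
  have E := @bin_mul_fact n j n 0 (leq_ord j).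
  transitivity ((-1) ^+ n * (-1) ^+ j * n.+1%:R * 'C(n.+1, j)%:R *
     ('C(n, j)%:R * ((n - j + 0)`!%:R * (j + n)`!%:R))
       / (2 * n + 1)`!%:R : rat); first by rewrite [(n + 1)%N]addn1 exprD; ring.
  by rewrite E !ffactn0 factS natrM; ring.
rewrite alt ffactn0 mulr1 exprS.
have fact2n1 : ((n + n).+1 ^_ n * n.+1`! = (2 * n + 1)`!)%N.
  rewrite -(_ : ((n + n).+1 - n)%N = n.+1); last by lia.
  by rewrite ffact_fact; [congr _`!|]; lia.
have /(congr1 (GRing.natmul (1 : rat))) := fact2n1; rewrite natrM => E.
transitivity (((-1) ^+ n * (-1) ^+ n) *
   (((n + n).+1 ^_ n)%:R * n.+1`!%:R) / (2 * n + 1)`!%:R : rat); first by ring.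
rewrite -expr2 sqrr_sign mul1r E divff // pnatr_eq0 -lt0n.
exact: fact_gt0.
Qed.

Lemma bezw_uv a b : (a <= n.+1)%N -> (b <= n.+1)%N ->
  (v n.+1 n.+1)^-1 * bezw (u n) (v n.+1) a b =
  (-1) ^+ (a + b).+1 * (b%:R - a%:R) *
  'C(n.+1, a)%:R ^+ 2 * 'C(n.+1, b)%:R ^+ 2.
Proof.
move=> lea leb; apply: (mulfI v_last_neq0).
rewrite mulVKf ?v_last_neq0 // /bezw !uE // !vE binn !exprS !exprD.
by ring.
Qed.

Lemma MtildeE : Mtilde n = \matrix_(i, j) h (i + j).
Proof. by apply/matrixP => i j; rewrite !mxE /h subnDA natrM. Qed.

Lemma bezout_mul_Mtilde :
  ((v n.+1 n.+1)^-1 *: \matrix_(i, j) bezout_coef (u n) (v n.+1) i j)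
    *m Mtilde n = 1%:M.
Proof.
rewrite MtildeE -scalemxAl (bezout_mul_hankel u_gt v_gt u_orth u_norm v_orth).
by rewrite scale_scalar_mx mulVf // v_last_neq0.
Qed.

End FactorialMoments.

Theorem theorem3p3 (n : nat) :
  Mtilde n \in unitmx /\
  forall i j : 'I_n.+1,
    invmx (Mtilde n) i j =
      (v n.+1 n.+1)^-1 *
      (\sum_(0 <= k < (minn i (n - j)).+1)
         (u n (i - k) * v n.+1 (j + k + 1) - u n (j + k + 1) * v n.+1 (i - k)))
    /\
    (v n.+1 n.+1)^-1 *
      (\sum_(0 <= k < (minn i (n - j)).+1)
         (u n (i - k) * v n.+1 (j + k + 1) - u n (j + k + 1) * v n.+1 (i - k)))
    = (-1) ^+ (i + j) *
      (\sum_(0 <= k < (minn i (n - j)).+1)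
         (2 * k%:R + 1 - i%:R + j%:R)
         * 'C(n + 1, i - k)%:R ^+ 2 * 'C(n + 1, j + k + 1)%:R ^+ 2).
Proof.
have [_ unitM] := mulmx1_unit (bezout_mul_Mtilde n).
split=> // i j; split.
  rewrite -(bezout_coef_minn (@u_gt n) (@v_gt n) i (_ : j <= n)%N) -1?ltnS //.
  by rewrite -[invmx _]mul1mx -(bezout_mul_Mtilde n) mulmxK // !mxE.
rewrite !mulr_sumr !big_nat; apply: eq_bigr => k /=.
rewrite ltnS leq_min => /andP[leki lekj].
have lti := ltn_ord i; have ltj := ltn_ord j.
rewrite -/(bezw _ _ _ _) bezw_uv; [|lia|lia].
have -> : ((i - k + (j + k + 1)).+1 = (i + j).+2)%N by lia.
by rewrite natrB // !natrD [(n + 1)%N]addn1 2!exprS; ring.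
Qed.
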